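(* Let $R>0$ be a real number. Then $R=3$ if and only if every line in $\mathrm{P}C$ (for the parameter $R$) is the projectivization $\mathrm{P}X=\{x\in X: x\neq 0\}/\mathbb{R}^*$ of a 2-dimensional null subspace $X\subset \mathrm{Im}(\mathbb{H})\oplus\mathbb{H}$.
   Context: $\mathbb{H}$ denotes the quaternions with conjugation $x\mapsto\overline{x}$ and norm $|x|^2=x\overline{x}$; $\mathrm{Im}(\mathbb{H})=\{x\in\mathbb{H}:\overline{x}=-x\}$ is identified with $\mathbb{R}^3$. $S^2$ is the set of unit vectors in $\mathrm{Im}(\mathbb{H})\cong\mathbb{R}^3$, and $\mathrm{SU}(2)$ is identified with the group of unit quaternions. The double cover $\mathrm{SU}(2)\to\mathrm{SO}(3)$ sends $q$ to the rotation $x\mapsto qxq^{-1}$ of $\mathrm{Im}(\mathbb{H})$. On the 7-dimensional real vector space $\mathrm{Im}(\mathbb{H})\oplus\mathbb{H}$ let $Q(a,b)=|a|^2-|b|^2$. Let $C=\{x\in\mathrm{Im}(\mathbb{H})\oplus\mathbb{H}: Q(x)=0\}$ and $\mathrm{P}C=\{x\in C:x\ne0\}/\mathbb{R}^*$. A null subspace is a linear subspace consisting entirely of vectors $x$ with $Q(x)=0$. A point of $\mathrm{P}C$ is written $\pm(v,q)$, the class of a vector $(v,q)$ with $|v|=|q|=1$. Lines (these depend on the radius $R$ of a fixed ball on which a ball of radius $1$ rolls): - A line in $S^2\times\mathrm{SO}(3)$ is any subset of the form $\{(\cos(\Phi)u+\sin(\Phi)v,\ \mathbf{R}(u\times v,(1+R)\Phi)\,g):\Phi\in\mathbb{R}\}$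 with $u,v\in\mathbb{R}^3$ orthogonal unit vectors and $g\in\mathrm{SO}(3)$, where $\mathbf{R}(w,\alpha)$ is the right-handed rotation by angle $\alpha$ about the unit vector $w$. - A line in $S^2\times\mathrm{SU}(2)$ is the inverse image of a line in $S^2\times\mathrm{SO}(3)$ under the covering map $S^2\times\mathrm{SU}(2)\to S^2\times\mathrm{SO}(3)$. - A line in $\mathbb{R}\mathrm{P}^2\times\mathrm{SU}(2)$ is the image of a line in $S^2\times\mathrm{SU}(2)$ under the double cover $(v,q)\mapsto(\pm v,q)$. - A line in $\mathrm{P}C$ is the image of a line in $\mathbb{R}\mathrm{P}^2\times\mathrm{SU}(2)$ under the diffeomorphism $\tau\colon\mathbb{R}\mathrm{P}^2\times\mathrm{SU}(2)\to\mathrm{P}C$, $(\pm v,q)\mapsto\pm(v,vq)$.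
   Formalization: A line in S²×SU(2) is taken to be a path component of the inverse image of a line in S²×SO(3), not the whole inverse image; the whole one is stable under q ↦ -q, so X would contain the non-null vector (0,2vq), and the claim would fail at R=3. *)

(* Defs.v *)
From HB Require Import structures.
From mathcomp Require Import all_boot all_order all_algebra.
From mathcomp Require Import ring lra.
From mathcomp Require Import all_classical all_reals all_analysis.

Set Implicit Arguments.
Unset Strict Implicit.
Unset Printing Implicit Defensive.

Import Order.TTheory GRing.Theory Num.Theory.
Import numFieldNormedType.Exports.

Local Open Scope classical_set_scope.
Local Open Scope ring_scope.

Section Space3.
Context {R : realType}.
Implicit Types (u v w : 'cV[R]_3) (f : 'cV[R]_3 -> 'cV[R]_3).

Definition dot u v : R := \sum_i u i 0 * v i 0.

(* Indices are added in 'I_3, i.e. modulo 3. *)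
Definition cross u v : 'cV[R]_3 :=
  \col_i (u (i + 1) 0 * v (i + 2%:R) 0 - u (i + 2%:R) 0 * v (i + 1) 0).

Definition mx_of f : 'M[R]_3 := \matrix_(i, j) f (delta_mx j 0) i 0.

(* The component p of x along the unit vector w is fixed, and the orthogonal
   component x - p is turned by the angle a towards cross w (x - p). *)
Definition rotation w (a : R) : 'M[R]_3 := mx_of (fun x =>
  let p := dot w x *: w in p + cos a *: (x - p) + sin a *: cross w (x - p)).

Definition SO3 : set 'M[R]_3 := [set A | A^T *m A = 1%:M /\ \det A = 1].

Definition S2 : set 'cV[R]_3 := [set v | dot v v = 1].

End Space3.

(* (a, u) stands for a + u with u in Im(H) = R^3; see imqP. *)
Definition quat (R : realType) : Type := (R^o * 'cV[R]_3)%type.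

HB.instance Definition _ (R : realType) :=
  Vector.copy (quat R) (R^o * 'cV[R]_3)%type.
HB.instance Definition _ (R : realType) :=
  Topological.copy (quat R) (R^o * 'cV[R]_3)%type.

Section Coordinates.
Context {R : realType}.

Lemma dotE (u v : 'cV[R]_3) :
  dot u v = u 0 0 * v 0 0 + u 1 0 * v 1 0 + u 2%:R 0 * v 2%:R 0.
Proof.
rewrite /dot !big_ord_recl big_ord0 addr0 addrA.
by congr (_ * _ + _ * _ + _ * _); congr (_ _ _); apply: val_inj.
Qed.

Lemma col3P (u v : 'cV[R]_3) :
  u 0 0 = v 0 0 -> u 1 0 = v 1 0 -> u 2%:R 0 = v 2%:R 0 -> u = v.
Proof.
move=> h0 h1 h2; apply/colP => -[[|[|[|//]]] hi].
- by rewrite (_ : Ordinal hi = 0) //; apply: val_inj.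
- by rewrite (_ : Ordinal hi = 1) //; apply: val_inj.
- by rewrite (_ : Ordinal hi = 2%:R) //; apply: val_inj.
Qed.

Lemma ord3D : (1 + 1 = 2%:R :> 'I_3) * (1 + 2%:R = 0 :> 'I_3) *
  (2%:R + 1 = 0 :> 'I_3) * (2%:R + 2%:R = 1 :> 'I_3).
Proof. by do ![split]; apply: val_inj. Qed.

Lemma regE (a : R) (b : R^o) : a *: b = a * b. Proof. by []. Qed.

Lemma quatP (x y : quat R) : x.1 = y.1 -> x.2 = y.2 -> x = y.
Proof. by case: x y => [a u] [b v] /= -> ->. Qed.

Lemma qext (x y : quat R) :
  [/\ x.1 = y.1, x.2 0 0 = y.2 0 0, x.2 1 0 = y.2 1 0
    & x.2 2%:R 0 = y.2 2%:R 0] -> x = y.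
Proof. by case=> h0 h1 h2 h3; apply/quatP => //; apply: col3P. Qed.

End Coordinates.

Local Ltac coords := rewrite /= ?regE ?dotE ?mxE ?(add0r, ord3D) ?mxE.

Local Ltac qcoords := apply: qext; split; coords; rewrite /GRing.regular; ring.

Section QuaternionRing.
Context {R : realType}.
Implicit Types x y z : quat R.

Definition qone : quat R := (1, 0).

(* Hamilton's product: i j = k, i.e. u v = - u . v + u x v for u, v in Im(H). *)
Definition qmul x y : quat R :=
  (x.1 * y.1 - dot x.2 y.2, x.1 *: y.2 + y.1 *: x.2 + cross x.2 y.2).

Lemma qmulA : associative qmul.
Proof. move=> [/= a u] [b v] [c w]; qcoords. Qed.

Lemma qmul1l : left_id qone qmul.
Proof. move=> [a u]; qcoords. Qed.

Lemma qmul1r : right_id qone qmul.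
Proof. move=> [a u]; qcoords. Qed.

Lemma qmulDl : left_distributive qmul +%R.
Proof. move=> [/= a u] [b v] [c w]; qcoords. Qed.

Lemma qmulDr : right_distributive qmul +%R.
Proof. move=> [/= a u] [b v] [c w]; qcoords. Qed.

Lemma qone_neq0 : qone != 0.
Proof. by apply/eqP => -[] /eqP; rewrite oner_eq0. Qed.

Lemma qscaleAl (a : R) x y : a *: qmul x y = qmul (a *: x) y.
Proof. by case: x y => [b u] [c v]; qcoords. Qed.

Lemma qscaleAr (a : R) x y : a *: qmul x y = qmul x (a *: y).
Proof. by case: x y => [b u] [c v]; qcoords. Qed.

End QuaternionRing.

HB.instance Definition _ (R : realType) :=
  GRing.Zmodule_isNzRing.Build (quat R)
    (@qmulA R) (@qmul1l R) (@qmul1r R) (@qmulDl R) (@qmulDr R) (@qone_neq0 R).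
HB.instance Definition _ (R : realType) :=
  GRing.Lmodule_isLalgebra.Build R (quat R) (@qscaleAl R).
HB.instance Definition _ (R : realType) :=
  GRing.Lalgebra_isAlgebra.Build R (quat R) (@qscaleAr R).

Section QuaternionInverse.
Context {R : realType}.
Implicit Types x y : quat R.

Definition qconj x : quat R := (x.1, - x.2).

Definition qnorm2 x : R := (x * qconj x).1.

Definition qinv x : quat R := (qnorm2 x)^-1 *: qconj x.

Lemma qnorm2E x : qnorm2 x = x.1 ^+ 2 + dot x.2 x.2.
Proof. by case: x => a u; rewrite /qnorm2 /=; coords; rewrite /GRing.regular; ring. Qed.

Lemma mulq_conj x : x * qconj x = (qnorm2 x)%:A.
Proof. case: x => a u; rewrite qnorm2E; qcoords. Qed.

Lemma conj_mulq x : qconj x * x = (qnorm2 x)%:A.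
Proof. case: x => a u; rewrite qnorm2E; qcoords. Qed.

Lemma dot_ge0 (u : 'cV[R]_3) : 0 <= dot u u.
Proof. by apply: sumr_ge0 => i _; rewrite -expr2 sqr_ge0. Qed.

Lemma dot_eq0 (u : 'cV[R]_3) : (dot u u == 0) = (u == 0).
Proof.
apply/idP/eqP => [|->]; last by rewrite /dot big1// => i _; rewrite mxE mul0r.
rewrite psumr_eq0; last by move=> i _; rewrite -expr2 sqr_ge0.
move/allP => h; apply/colP => i; rewrite mxE; apply/eqP.
by have := h i (mem_index_enum _); rewrite -expr2 sqrf_eq0.
Qed.

Lemma qnorm2_eq0 x : (qnorm2 x == 0) = (x == 0).
Proof.
by rewrite qnorm2E paddr_eq0 ?sqr_ge0 ?dot_ge0// sqrf_eq0 dot_eq0; case: x.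
Qed.

Lemma qmulVr : {in predC1 0, left_inverse 1 qinv *%R}.
Proof.
move=> x; rewrite inE /= => x0.
by rewrite /qinv -scalerAl conj_mulq scalerA mulVf ?qnorm2_eq0// scale1r.
Qed.

Lemma qmulrV : {in predC1 0, right_inverse 1 qinv *%R}.
Proof.
move=> x; rewrite inE /= => x0.
by rewrite /qinv -scalerAr mulq_conj scalerA mulVf ?qnorm2_eq0// scale1r.
Qed.

Lemma qunitPl x y : y * x = 1 /\ x * y = 1 -> x \in predC1 0.
Proof.
case=> yx _; rewrite inE /=; apply: contra_eqN yx => /eqP ->.
by rewrite mulr0 eq_sym oner_neq0.
Qed.

Lemma qinv_out : {in [predC predC1 0], qinv =1 id}.
Proof.
move=> x; rewrite inE /= negbK => /eqP ->.
by rewrite /qinv (_ : qconj 0 = 0) ?scaler0// /qconj /= oppr0.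
Qed.

End QuaternionInverse.

HB.instance Definition _ (R : realType) :=
  GRing.NzRing_hasMulInverse.Build (quat R)
    (@qmulVr R) (@qmulrV R) (@qunitPl R) (@qinv_out R).

Section Geometry.
Context {R : realType}.

Definition imq (v : 'cV[R]_3) : quat R := (0, v).

Lemma imqP (x : quat R) : qconj x = - x <-> exists v, x = imq v.
Proof.
split=> [|[v ->]]; last by rewrite /qconj /imq /=; congr (_, _); rewrite oppr0.
case: x => a u [] h; exists u; congr (_, _); rewrite /GRing.regular in a h *.
by lra.
Qed.

Definition SU2 : set (quat R) := [set q | qnorm2 q = 1].

(* The matrix of the rotation x |-> q x q^-1 of Im(H). *)
Definition spin_cover (q : quat R) : 'M[R]_3 := mx_of (fun x => (q * imq x * q^-1).2).

Lemma mx_ofE (f : 'cV[R]_3 -> 'cV[R]_3) (x : 'cV[R]_3) :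
  linear f -> mx_of f *m x = f x.
Proof.
move=> linf; pose g := HB.pack_for {linear 'cV[R]_3 -> 'cV[R]_3} f
  (GRing.isLinear.Build _ _ _ _ f linf).
rewrite -[f x]/(g x) [x in RHS](_ : x = \sum_j x j 0 *: delta_mx j 0).
  rewrite linear_sum; apply/colP => i; rewrite mxE summxE.
  by apply: eq_bigr => j _; rewrite linearZ !mxE mulrC.
apply/colP => i; rewrite summxE (bigD1 i)//= big1 ?addr0 => [|j ji].
  by rewrite !mxE !eqxx mulr1.
by rewrite !mxE eq_sym (negbTE ji) mulr0.
Qed.

Lemma spin_coverE (q : quat R) (x : 'cV[R]_3) :
  SU2 q -> imq (spin_cover q *m x) = q * imq x * q^-1.
Proof.
move=> q1; rewrite mx_ofE => [|a u v].
  have -> : q^-1 = qconj q.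
    by rewrite -[LHS]/(qinv q) /qinv (q1 : qnorm2 q = 1) invr1 scale1r.
  apply: quatP => //=.
  by case: q {q1} => b w; coords; rewrite /GRing.regular; ring.
rewrite -[RHS]/((a *: (q * imq u * q^-1) + q * imq v * q^-1).2).
have -> : imq (a *: u + v) = a *: imq u + imq v.
  by apply: quatP => //=; rewrite regE mulr0 addr0.
by rewrite mulrDr mulrDl -(scalerAr a q) -(scalerAl a (q * imq u)).
Qed.

Definition Qform (x : 'cV[R]_3 * quat R) : R := qnorm2 (imq x.1) - qnorm2 x.2.

Definition Ccone : set ('cV[R]_3 * quat R) := [set x | Qform x = 0].

(* A point of projective space is its equivalence class under R^*, as a set. *)
Definition pclass (x : 'cV[R]_3 * quat R) : set ('cV[R]_3 * quat R) :=
  [set t *: x | t in [set t : R | t != 0]].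

Definition PC : set (set ('cV[R]_3 * quat R)) :=
  [set pclass x | x in [set x | Ccone x /\ x != 0]].

Definition null_subspace (X : {vspace 'cV[R]_3 * quat R}) : Prop :=
  forall x, x \in X -> Ccone x.

Definition projectivization (X : {vspace 'cV[R]_3 * quat R}) :
    set (set ('cV[R]_3 * quat R)) :=
  [set pclass x | x in [set x | x \in X /\ x != 0]].

(* A point +-v of RP^2 is the set {v, -v}, with v in S2. *)
Definition pm (v : 'cV[R]_3) : set 'cV[R]_3 := [set v; - v].

(* (+-v, q) |-> +-(v, v q); see tauE. *)
Definition tau (p : set 'cV[R]_3 * quat R) : set ('cV[R]_3 * quat R) :=
  [set t *: (v, imq v * p.2) | v in p.1 & t in [set t : R | t != 0]].

Lemma tauE (v : 'cV[R]_3) (q : quat R) :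
  tau (pm v, q) = pclass (v, imq v * q).
Proof.
have imN : (- v, imq (- v) * q) = - (v, imq v * q).
  congr (_, _); rewrite -mulNr; congr (_ * _).
  by apply: quatP => //=; rewrite oppr0.
apply/seteqP; split=> [_ [w /= [->|->] [t t0 <-]]|_ [t t0 <-]].
- by exists t.
- by exists (- t); rewrite /= ?oppr_eq0// imN scalerN scaleNr.
- by exists v; [left|exists t].
Qed.

Lemma tau_PC (v : 'cV[R]_3) (q : quat R) :
  S2 v -> SU2 q -> PC (tau (pm v, q)).
Proof.
move=> v1 q1; rewrite tauE; exists (v, imq v * q) => //; split.
  rewrite /Ccone /Qform /=.
  have -> : qnorm2 (imq v * q) = qnorm2 (imq v) * qnorm2 q.
    by case: q {q1} => b w; rewrite !qnorm2E; coords; rewrite /GRing.regular; ring.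
  by rewrite (q1 : qnorm2 q = 1) mulr1 subrr.
apply/eqP => -[v0 _]; move: v1; rewrite v0 /S2 /= => /eqP.
by rewrite (eqP (_ : dot 0 0 == 0)) ?dot_eq0// eq_sym oner_eq0.
Qed.

Context (rho : R).

Definition line_SO3 : set (set ('cV[R]_3 * 'M[R]_3)) :=
  [set L | exists u v g,
    [/\ S2 u, S2 v, dot u v = 0, SO3 g &
      L = [set (cos phi *: u + sin phi *: v,
                rotation (cross u v) ((1 + rho) * phi) *m g) | phi in [set: R]]]].

Definition preimage_cover (L : set ('cV[R]_3 * 'M[R]_3)) :
    set ('cV[R]_3 * quat R) :=
  [set p | [/\ S2 p.1, SU2 p.2 & L (p.1, spin_cover p.2)]].

Definition path_component (T : topologicalType) (A : set T) (x : T) : set T :=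
  [set y | exists gamma : R -> T,
    [/\ {within `[0, 1], continuous gamma},
        forall t, t \in `[0, 1] -> A (gamma t), gamma 0 = x & gamma 1 = y]].

(* The inverse image of a line is invariant under q |-> - q. Depending on rho it
   is one curve or, as for rho = 3, the disjoint union of two curves exchanged by
   this involution. A line is one such curve: a 2-dimensional null subspace
   contains no two vectors (v, v q) and (v, - v q), so the projectivization of
   such a subspace never is the image of the whole inverse image. *)
Definition line_SU2 : set (set ('cV[R]_3 * quat R)) :=
  [set M | exists2 L, line_SO3 L &
    exists2 p, preimage_cover L p & M = path_component (preimage_cover L) p].

Definition line_RP2 : set (set (set 'cV[R]_3 * quat R)) :=
  [set N | exists2 M, line_SU2 M & N = [set (pm p.1, p.2) | p in M]].

Definition line_PC : set (set (set ('cV[R]_3 * quat R))) :=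
  [set K | exists2 N, line_RP2 N & K = tau @` N].

End Geometry.

(* Main.v *)
Require Import Defs.
From mathcomp Require Import all_boot all_order all_algebra.
From mathcomp Require Import ring lra.
From mathcomp Require Import all_classical all_reals all_analysis.

(** Let u, v be orthonormal in R^3, w = u x v, x_t = cos t u + sin t v, and let
exp(a w) = cos a + sin a w. Since exp(a w) covers the rotation by 2 a about w, a
line of parameter rho lifts to the curve of pairs (x_t, exp(k t w) q) with
k = (1 + rho) / 2, together with its translate under q |-> - q. A line can be
based at any of its points, so one may let q be the spin coordinate of the chosen
point ([line_SU2P]).

Quaternion multiplication gives x_t exp(a w) = x_(t - a) ([circ_turn]), so in PC
the curve becomes the set of classes of (x_t, x_(m t) q), where
m = 1 - k = (1 - rho) / 2 ([tau_roll]). Everything depends on this slope m.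

If rho = 3 then m = -1: both x_t and x_(- t) are linear in (cos t, sin t), so the
curve consists of the unit vectors of a fixed null plane, and the unit vectors of
a plane represent all of its directions ([proj_plane]). The other lift has to be
excluded: for k = 2 the pair (x, q') with q' = +- exp(2 t w) q determines its
sign, because exp(2 t w) is a quadratic polynomial in x = x_t; the sign is thus a
continuous function ([sheet]), which is constant along paths
([component_two_rolls]).

Conversely, if the line lies in a null subspace, then the difference of the
vectors at parameters t and 0 is null. As |x_t - x_0|^2 = 2 - 2 cos t, this says
cos t = cos (m t) for all t, whence |m| = 1 ([cos_scale_norm]); for rho > 0 this
leaves only rho = 3. *)

Set Implicit Arguments.
Unset Strict Implicit.
Unset Printing Implicit Defensive.

Import Order.TTheory GRing.Theory Num.Theory.
Import numFieldNormedType.Exports.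

Local Open Scope classical_set_scope.
Local Open Scope ring_scope.

(* These reduce vector and quaternion identities to polynomial identities
   between coordinates. *)
Local Ltac coords := rewrite /= ?regE ?dotE ?mxE ?(add0r, ord3D) ?mxE.
Local Ltac qcoords := apply: qext; split; coords; rewrite /GRing.regular.

(** * Unit quaternions and rotations *)
Section Quaternions.
Context {R : realType}.
Implicit Types (u v w : 'cV[R]_3) (q r : quat R) (a b t : R).

(** The exponential exp(a w) of an imaginary quaternion, for a unit vector w. *)
Definition turn w a : quat R := (cos a, sin a *: w).

Lemma qnorm2M q r : qnorm2 (q * r) = qnorm2 q * qnorm2 r.
Proof.
case: q r => a u [b v]; rewrite !qnorm2E; coords; rewrite /GRing.regular.
ring.
Qed.

Lemma SU2M q r : SU2 q -> SU2 r -> SU2 (q * r).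
Proof. by rewrite /SU2 /= qnorm2M => -> ->; rewrite mulr1. Qed.

Lemma SU2_1 : SU2 (1 : quat R).
Proof.
by rewrite /SU2 /= qnorm2E /= expr1n (eqP (_ : dot 0 0 == 0)) ?dot_eq0// addr0.
Qed.

Lemma SU2_unit q : SU2 q -> q \is a GRing.unit.
Proof.
by rewrite unfold_in /= -qnorm2_eq0 => ->; rewrite oner_eq0.
Qed.

Lemma SU2_inv q : SU2 q -> q^-1 = qconj q.
Proof.
by move=> q1; rewrite -[LHS]/(qinv q) /qinv (q1 : qnorm2 q = 1) invr1 scale1r.
Qed.

Lemma SU2_turn w a : S2 w -> SU2 (turn w a).
Proof.
rewrite /SU2 /S2 /= => w1; rewrite qnorm2E /= -(cos2Dsin2 a); congr (_ + _).
rewrite -[RHS]mulr1 -w1; coords; ring.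
Qed.

Lemma turnE w a : turn w a = (cos a)%:A + sin a *: imq w.
Proof. by qcoords; ring. Qed.

Lemma turn_mulE w t q : turn w t * q = cos t *: q + sin t *: (imq w * q).
Proof. by rewrite turnE mulrDl mulr_algl -scalerAl. Qed.

Lemma turnD w a b : S2 w -> turn w (a + b) = turn w a * turn w b.
Proof.
rewrite /S2 /= dotE => w1; rewrite /turn cosD sinD; qcoords; try ring.
by rewrite -[sin a * sin b]mulr1 -{}w1; ring.
Qed.

(** Conjugation by exp(a w) turns by the angle 2 a. This doubling is why the
rolling factor 1 + rho becomes (1 + rho) / 2 on unit quaternions. *)
Lemma spin_turn w a : S2 w -> spin_cover (turn w a) = rotation w (a *+ 2).
Proof.
move=> w1; rewrite /spin_cover /rotation; congr mx_of; apply/funext => x.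
rewrite SU2_inv; last exact: SU2_turn.
have -> : cos (a *+ 2) = cos a ^+ 2 - sin a ^+ 2.
  by rewrite mulr2n cosD !expr2.
have -> : sin (a *+ 2) = cos a * sin a *+ 2.
  by rewrite mulr2n sinD [sin a * _]mulrC mulr2n.
have cs := cos2Dsin2 a; rewrite /turn /=; move: (cos a) (sin a) cs => c s cs.
(* Rodrigues' form of (c + s w) x (c - s w), valid before normalizing w. *)
transitivity ((c ^+ 2 - s ^+ 2 * dot w w) *: x + (s ^+ 2 *+ 2 * dot w x) *: w
   + (c * s *+ 2) *: cross w x).
  by apply: col3P; coords; rewrite /GRing.regular; ring.
rewrite w1 mulr1.
have -> : s ^+ 2 *+ 2 = 1 - (c ^+ 2 - s ^+ 2) by rewrite -cs; ring.
by apply: col3P; coords; ring.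
Qed.

Lemma mulmx_inj (A B : 'M[R]_3) : (forall x : 'cV_3, A *m x = B *m x) -> A = B.
Proof.
move=> AB; apply/matrixP => i j.
have /colP/(_ i) := AB (delta_mx j 0).
by rewrite -!colE !mxE.
Qed.

Lemma imq_inj : injective (@imq R).
Proof. by move=> x y []. Qed.

Lemma spin_cover1 : spin_cover (1 : quat R) = 1%:M.
Proof.
apply: mulmx_inj => x; apply: imq_inj.
by rewrite (spin_coverE _ SU2_1) mul1mx invr1 mul1r mulr1.
Qed.

Lemma spin_coverM q r : SU2 q -> SU2 r ->
  spin_cover (q * r) = spin_cover q *m spin_cover r.
Proof.
move=> q1 r1; apply: mulmx_inj => x; apply: imq_inj.
rewrite -mulmxA !spin_coverE//; last exact: SU2M.
by rewrite invrM ?SU2_unit// !mulrA.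
Qed.

(** The commutator of an imaginary part with x is twice a cross product, which
vanishes for all x only when the imaginary part does. *)
Lemma commute_imq q : (forall x, q * imq x = imq x * q) -> q.2 = 0.
Proof.
case: q => a u /= qx.
have h i := congr1 (fun r : quat R => r.2) (qx (delta_mx i 0)).
apply: col3P; rewrite mxE.
- by move: (h 1) => /colP/(_ 2%:R); coords; rewrite /= /GRing.regular; lra.
- by move: (h 2%:R) => /colP/(_ 0); coords; rewrite /= /GRing.regular; lra.
- by move: (h 0) => /colP/(_ 1); coords; rewrite /= /GRing.regular; lra.
Qed.

(** The kernel of the double cover is {1, -1}: if q and r induce the same
rotation, then r^-1 q is central, hence a real number of norm 1. *)
Lemma spin_cover_eq q r : SU2 q -> SU2 r ->
  spin_cover q = spin_cover r <-> q = r \/ q = - r.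
Proof.
move=> q1 r1; split=> [qr|[->//|->]]; last first.
  rewrite /spin_cover; congr mx_of; apply/funext => x.
  by rewrite invrN mulrN !mulNr opprK.
have qU := SU2_unit q1; have rU := SU2_unit r1.
have s0 : (r^-1 * q).2 = 0.
  apply: commute_imq => x; have := spin_coverE x q1.
  rewrite qr (spin_coverE x r1) => /(congr1 (fun z => r^-1 * z * q)).
  by rewrite !mulrA mulVr// mul1r -[_ * q^-1 * q]mulrA mulVr// mulr1 => <-.
have /= s1 : qnorm2 (r^-1 * q) = 1.
  rewrite qnorm2M (q1 : qnorm2 q = 1) mulr1 SU2_inv// -r1 !qnorm2E /=.
  by congr (_ + _); coords; ring.
have := mulVKr rU q.
have : (r^-1 * q).1 ^+ 2 = 1.
  by rewrite -s1 qnorm2E s0 (eqP (_ : dot 0 0 == 0)) ?dot_eq0// addr0.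
case: (r^-1 * q) s0 => a _ /= -> /eqP; rewrite sqrf_eq1.
case/orP => /eqP -> qE; [left|right]; rewrite -qE.
  exact: mulr1.
rewrite -[RHS]mulrN1; congr (_ * _).
by apply: quatP; rewrite //= oppr0.
Qed.

End Quaternions.

(** * Great circles and lines *)
Section Lines.
Context {R : realType}.
Implicit Types (u v w : 'cV[R]_3) (q r : quat R) (a b t k rho : R).

Definition circ u v t := cos t *: u + sin t *: v.

Lemma circ0 u v : circ u v 0 = u.
Proof. by rewrite /circ cos0 sin0 scale1r scale0r addr0. Qed.

Definition orthonormal u v := [/\ S2 u, S2 v & dot u v = 0].

Lemma cross_S2 u v : orthonormal u v -> S2 (cross u v).
Proof.
rewrite /S2 /= => -[u1 v1 uv].
have -> : dot (cross u v) (cross u v) = dot u u * dot v v - dot u v ^+ 2.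
  by coords; ring.
by rewrite u1 v1 uv; ring.
Qed.

Lemma dot_circ u v a b : orthonormal u v -> dot (circ u v a) (circ u v b) = cos (a - b).
Proof.
case=> u1 v1 uv; rewrite cosB.
have -> : dot (circ u v a) (circ u v b) = cos a * cos b * dot u u +
   sin a * sin b * dot v v + (cos a * sin b + sin a * cos b) * dot u v.
  by coords; ring.
by rewrite u1 v1 uv; ring.
Qed.

(** With w = u x v, the quaternion identities u w = - v and v w = u make right
multiplication by exp(a w) a backward rotation of the oriented plane (u, v). This
is what turns the map (v, q) |-> (v, v q) into a change of angular speed. *)
Lemma circ_turn u v t a : orthonormal u v ->
  imq (circ u v t) * turn (cross u v) a = imq (circ u v (t - a)).
Proof.
move=> [u1 v1 uv].
have uw : imq u * imq (cross u v) = - imq v.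
  transitivity (imq (dot u v *: u - dot u u *: v)); first by qcoords; ring.
  by rewrite uv u1 scale0r scale1r add0r; qcoords; rewrite ?oppr0.
have vw : imq v * imq (cross u v) = imq u.
  transitivity (imq (dot v v *: u - dot u v *: v)); first by qcoords; ring.
  by rewrite uv v1 scale0r scale1r subr0.
have circE b : imq (circ u v b) = cos b *: imq u + sin b *: imq v.
  by qcoords; ring.
rewrite turnE !circE mulrDr mulr_algr mulrDl -!scalerAl -!scalerAr uw vw.
rewrite cosB sinB !scalerDr !scalerDl scalerN !scalerA.
by qcoords; ring.
Qed.

(** A great circle may start from any of its points: the oriented frame is turned
within its plane, which does not affect the normal u x v. *)
Lemma circ_rebase u v a (v' := circ v (- u) a) : orthonormal u v ->
  [/\ orthonormal (circ u v a) v', cross (circ u v a) v' = cross u v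
    & forall t, circ (circ u v a) v' t = circ u v (a + t)].
Proof.
move=> uv; have [u1 v1 uv0] := uv.
have u'1 : S2 (circ u v a) by rewrite /S2 /= dot_circ// subrr cos0.
have cs := cos2Dsin2 a.
split.
- split=> //; rewrite /v' /S2 /= /circ.
    transitivity (cos a ^+ 2 * dot v v + sin a ^+ 2 * dot u u
      - cos a * sin a *+ 2 * dot u v); first by coords; ring.
    by rewrite u1 v1 uv0 -[RHS]cs; ring.
  transitivity (cos a * sin a * (dot v v - dot u u) +
    (cos a ^+ 2 - sin a ^+ 2) * dot u v); first by coords; ring.
  by rewrite u1 v1 uv0; ring.
- rewrite -[RHS]scale1r -cs /v' /circ.
  by apply: col3P; coords; ring.
- by move=> t; rewrite /v' /circ cosD sinD; apply: col3P; coords; ring.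
Qed.

Definition roll k u v q t : 'cV[R]_3 * quat R :=
  (circ u v t, turn (cross u v) (k * t) * q).

(** The two lifts may coincide as curves: whether they do depends on k. *)
Definition two_rolls k u v q : set ('cV[R]_3 * quat R) :=
  [set p | exists t, p = roll k u v q t \/ p = roll k u v (- q) t].

Lemma preimage_roll rho u v q : orthonormal u v -> SU2 q ->
  preimage_cover [set (circ u v t,
    rotation (cross u v) ((1 + rho) * t) *m spin_cover q) | t in [set: R]]
  = two_rolls ((1 + rho) / 2%:R) u v q.
Proof.
move=> uv q1; set w := cross u v; set k := _ / _.
have w1 : S2 w := cross_S2 uv.
have spinE t : rotation w ((1 + rho) * t) *m spin_cover q =
    spin_cover (turn w (k * t) * q).
  rewrite spin_coverM//; last exact: SU2_turn.
  by rewrite spin_turn//; congr (rotation _ _ *m _); rewrite /k; field.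
have tq1 t : SU2 (turn w (k * t) * q) by apply: SU2M => //; exact: SU2_turn.
apply/seteqP; split=> [[x r] /= [x1 r1 [t _ [xE]]]|p [t pE]].
  rewrite -xE spinE => /esym/spin_cover_eq => /(_ r1 (tq1 t)) [] ->; exists t.
    by left.
  by right; rewrite /roll mulrN.
have circ1 : S2 (circ u v t) by rewrite /S2 /= dot_circ// subrr cos0.
have tN1 : SU2 (- (turn w (k * t) * q)).
  by rewrite /SU2 /= -(tq1 t) !qnorm2E /=; coords; ring.
case: pE => ->; rewrite /roll -/w ?mulrN; split=> //=; exists t => //=;
  rewrite spinE; congr (_, _).
by apply/spin_cover_eq => //; rewrite ?opprK; right.
Qed.

(** Basing the line at the chosen point makes every line a component through the
initial point (u, q) of the curve; no lift of the given rotation g has to be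
constructed, because q itself lifts the rotation at the new base point. *)
Lemma line_SU2P rho M : line_SU2 rho M -> exists u v q, [/\ orthonormal u v,
  SU2 q & M = @path_component R _ (two_rolls ((1 + rho) / 2%:R) u v q) (u, q)].
Proof.
move=> [_ [u0 [v0 [g [u1 v1 uv g1 ->]]]] [[x q] [x1 q1 [a _ [xE qE]] ->]]].
have uv0 : orthonormal u0 v0 by [].
have [uv' wE circE] := circ_rebase a uv0.
exists x, (circ v0 (- u0) a), q; rewrite -xE; split=> //.
rewrite -preimage_roll//; congr (@path_component R _ (preimage_cover _) _).
rewrite wE -qE.
(* Rotations about a common axis compose by adding angles; this is read off from
   the exponentials that cover them. *)
have rotD b : rotation (cross u0 v0) ((1 + rho) * (a + b)) =
    rotation (cross u0 v0) ((1 + rho) * b) *m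
    rotation (cross u0 v0) ((1 + rho) * a).
  have w1 := cross_S2 uv0.
  have rotE t : rotation (cross u0 v0) t = spin_cover (turn (cross u0 v0) (t / 2%:R)).
    by rewrite spin_turn//; congr rotation; field.
  rewrite !rotE -spin_coverM; try exact: SU2_turn.
  by rewrite -turnD//; congr (spin_cover (turn _ _)); field.
apply/seteqP; split=> _ [t _ <-].
- exists (t - a) => //=; rewrite circE mulmxA -rotD.
  by rewrite addrC subrK.
- by exists (a + t) => //=; rewrite circE mulmxA -rotD.
Qed.

Lemma roll0 k u v q : roll k u v q 0 = (u, q).
Proof.
rewrite /roll circ0 mulr0 (_ : turn _ 0 = 1) ?mul1r//.
by rewrite /turn cos0 sin0 scale0r.
Qed.

(** The curve is a combination of four fixed vectors with trigonometric
coefficients. *)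
Lemma roll_continuous k u v q : continuous (roll k u v q).
Proof.
pose V : normedModType R := ('cV[R]_3 * (R^o * 'cV[R]_3))%type.
pose f t : V := cos t *: ((u, 0) : V) + sin t *: ((v, 0) : V) +
  (cos (k * t) *: ((0, q) : V) + sin (k * t) *: ((0, imq (cross u v) * q) : V)).
have -> : roll k u v q = f.
  apply/funext => t; rewrite /roll turn_mulE.
  rewrite /f; congr (_, _) => /=.
    by rewrite !scaler0 !addr0.
  by rewrite !scaler0 !add0r.
have kc : continuous ( *%R k) by move=> t; apply: cvgM; [exact: cvg_cst|exact: cvg_id].
have kct (h : R -> R) : continuous h -> continuous (fun t => h (k * t)).
  by move=> hc t; apply: continuous_comp; [exact: kc|exact: hc].
move=> t; apply: cvgD; apply: cvgD; apply: cvgZr_tmp.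
- exact: continuous_cos.
- exact: continuous_sin.
- exact: (kct _ (@continuous_cos R)).
- exact: (kct _ (@continuous_sin R)).
Qed.
End Lines.

(** * Separating the two lifts *)
Section Components.
Context {R : realType}.
Implicit Types (u v w : 'cV[R]_3) (q r : quat R) (a b t k rho : R).

Lemma roll_component k u v q :
  range (roll k u v q) `<=` @path_component R _ (two_rolls k u v q) (u, q).
Proof.
move=> _ [t _ <-]; exists (fun s => roll k u v q (t * s)); split.
- apply: continuous_subspaceT => s; apply: continuous_comp.
    by apply: cvgM; [exact: cvg_cst|exact: cvg_id].
  exact: roll_continuous.
- by move=> s _; exists (t * s); left.
- by rewrite mulr0 roll0.
- by rewrite mulr1.
Qed.

(** The Euclidean inner product of R^4. *)
Definition qdot q r : R := q.1 * r.1 + dot q.2 r.2.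

Lemma dot_continuous v : continuous (dot ^~ v).
Proof.
move=> u; apply: cvg_big => [||i _]; [exact: add_continuous|exact: nbhs_filter|].
by apply: cvgMr_tmp; [exact: nbhs_filter|exact: (@coord_continuous R 3 1 i 0 u)].
Qed.

Lemma qdot_continuous r : continuous (qdot ^~ r).
Proof.
move=> q; apply: cvgD.
  by apply: cvgMr_tmp; exact: cvg_fst.
by apply: (@continuous_comp _ _ _ snd (dot ^~ r.2)); [exact: cvg_snd|exact: dot_continuous].
Qed.

(** For x = x_t one has c = cos t and s = sin t, so this is the inner product of
p.2 with exp(2 t w) q, written as a polynomial in the coordinates of p. It extends
the choice of sign on the two lifts with k = 2 to a continuous function on the
whole space. *)
Definition sheet u v q (p : 'cV[R]_3 * quat R) : R :=
  let c := dot p.1 u in let s := dot p.1 v in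
  (c ^+ 2 - s ^+ 2) * qdot p.2 q +
  (c * s *+ 2) * qdot p.2 (imq (cross u v) * q).

Lemma sheet_continuous u v q : continuous (sheet u v q).
Proof.
have dc w : continuous (fun p : 'cV[R]_3 * quat R => dot p.1 w).
  by move=> p; apply: (@continuous_comp _ _ _ fst (dot ^~ w));
    [exact: cvg_fst|exact: dot_continuous].
have qc r : continuous (fun p : 'cV[R]_3 * quat R => qdot p.2 r).
  by move=> p; apply: (@continuous_comp _ _ _ snd (qdot ^~ r));
    [exact: cvg_snd|exact: qdot_continuous].
move=> p; apply: cvgD; apply: cvgM; try exact: qc.
- by apply: cvgB; rewrite expr2; apply: cvgM; exact: dc.
- by apply: cvgMn; apply: cvgM; exact: dc.
Qed.

Lemma sheet_roll u v q r t : orthonormal u v ->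
  sheet u v q (circ u v t, r) = qdot r (turn (cross u v) (2%:R * t) * q).
Proof.
move=> uv; have [u1 v1 uv0] := uv; rewrite /sheet /=.
have -> : dot (circ u v t) u = cos t.
  by rewrite -{2}(circ0 u v) dot_circ// subr0.
have -> : dot (circ u v t) v = sin t.
  transitivity (cos t * dot u v + sin t * dot v v); first by coords; ring.
  by rewrite uv0 v1; ring.
rewrite turn_mulE mulr_natl mulr2n cosD sinD /qdot.
by move: (imq _ * q) => [? ?]; coords; rewrite /GRing.regular; ring.
Qed.

(** The function [sheet] equals 1 on one lift and -1 on the other, so by the
intermediate value theorem no path joins them. *)
Lemma component_two_rolls u v q : orthonormal u v -> SU2 q ->
  @path_component R _ (two_rolls 2%:R u v q) (u, q) = range (roll 2%:R u v q).
Proof.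
move=> uv q1; apply/seteqP; split; last exact: roll_component.
have qdotNN r : qdot (- r) r = - qdot r r by rewrite /qdot; coords; ring.
have tq1 t : qdot (turn (cross u v) (2%:R * t) * q)
    (turn (cross u v) (2%:R * t) * q) = 1.
  rewrite /qdot -expr2 -qnorm2E; apply: SU2M => //; apply: SU2_turn.
  exact: cross_S2.
have sheet1 t : sheet u v q (roll 2%:R u v q t) = 1 by rewrite sheet_roll// tq1.
have sheetN1 t : sheet u v q (roll 2%:R u v (- q) t) = -1.
  by rewrite sheet_roll// mulrN qdotNN tq1.
move=> p [g [gc gA g0 g1]].
have : two_rolls 2%:R u v q p by rewrite -g1; apply: gA; rewrite in_itv /= ler01 lexx.
case=> t [->|pE]; first by exists t.
have [s s01 sg0] : exists2 s, s \in `[0, 1] & sheet u v q (g s) = 0.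
  apply: (@IVT R (sheet u v q \o g)) => //=.
    move=> s; apply: (@continuous_comp _ _ _ (from_subspace `[0, 1] g) (sheet u v q)).
      exact: gc.
    exact: sheet_continuous.
  rewrite g0 g1 pE sheetN1 -(roll0 2%:R u v q) sheet1.
  by rewrite ge_min le_max lerN10 ler01 orbT.
by case: (gA s s01) => t' [] gE; move: sg0; rewrite gE ?sheet1 ?sheetN1 => /eqP;
  rewrite ?oppr_eq0 oner_eq0.
Qed.

(** In PC a line is a pair of uniform circular motions, of speeds 1 and 1 - k. *)
Lemma tau_roll k u v q t : orthonormal u v ->
  tau (pm (roll k u v q t).1, (roll k u v q t).2) =
  pclass (circ u v t, imq (circ u v ((1 - k) * t)) * q).
Proof.
by move=> uv; rewrite tauE mulrA circ_turn//; congr (pclass (_, imq (circ _ _ _) * _)); ring.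
Qed.

End Components.

(** * Polar coordinates and the period of the cosine *)
Section Trigonometry.
Context {R : realType}.
Implicit Types a b k t : R.

Lemma polar a b : a ^+ 2 + b ^+ 2 = 1 -> exists t, cos t = a /\ sin t = b.
Proof.
move=> ab; have a1 : -1 <= a <= 1.
  by rewrite -ler_norml -(expr_le1 (n := 2))// real_normK ?num_real// -ab lerDl sqr_ge0.
have cE : cos (acos a) = a by rewrite acosK.
have sE : sin (acos a) = `|b|.
  by rewrite sin_acos// -ab addrC addKr sqrtr_sqr.
have [b0|b0] := leP 0 b.
  by exists (acos a); rewrite cE sE ger0_norm.
by exists (- acos a); rewrite cosN sinN cE sE ltr0_norm// opprK.
Qed.

(** The cosine first reaches -1 at pi, so it determines its period. The slower of
the two functions t |-> t and t |-> |k| t is compared with the faster one at the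
moment when the latter reaches pi: both arguments then lie in [0, pi], where the
cosine is injective. *)
Lemma cos_scale_norm k : (forall t, cos t = cos (k * t)) -> `|k| = 1.
Proof.
move=> kP; have {kP} : forall t, cos t = cos (`|k| * t).
  by move=> t; rewrite kP; case: (ger0P k) => // _; rewrite mulNr cosN.
move: `|k| (normr_ge0 k) => {}k k0 kP; have pi0 := pi_gt0 R.
have inj x y : 0 <= x <= pi -> 0 <= y <= pi -> cos x = cos y -> x = y :> R.
  by move=> x0 y0; apply: cos_inj; rewrite in_itv.
have [k1|k1] := leP k 1.
  have h : pi = k * pi.
    apply: inj => //; first by rewrite lexx ltW.
    by rewrite mulr_ge0 ?(ltW pi0)//= ger_pMl.
  by apply: (mulIf (lt0r_neq0 pi0)); rewrite mul1r -h.
have kp : 0 < k by rewrite (lt_trans ltr01).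
have h : pi / k = pi.
  apply: inj; first by rewrite divr_ge0 ?(ltW pi0)//= ler_pdivrMr// ler_peMr ?ltW.
    by rewrite lexx ltW.
  by rewrite kP mulrC divfK ?gt_eqF.
apply: (mulfI (lt0r_neq0 pi0)).
by rewrite mulr1 -{1}h divfK ?gt_eqF.
Qed.

End Trigonometry.

(** * Null planes and the value rho = 3 *)
Section Planes.
Context {R : realType}.
Implicit Types (u v w : 'cV[R]_3) (q r : quat R) (a b t k rho : R).

(** On (a, b) = (cos t, sin t) this is the pair (x_t, x_(- t) q). *)
Definition plane_pt u v q a b : 'cV[R]_3 * quat R :=
  (a *: u + b *: v, imq (a *: u - b *: v) * q).

Lemma plane_ptE u v q a b :
  plane_pt u v q a b = a *: plane_pt u v q 1 0 + b *: plane_pt u v q 0 1.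
Proof.
rewrite /plane_pt !scale1r !scale0r subr0 addr0 sub0r add0r; congr (_, _) => /=.
rewrite !scalerAl -mulrDl; congr (_ * _).
by qcoords; ring.
Qed.

Lemma plane_ptZ u v q c a b :
  c *: plane_pt u v q a b = plane_pt u v q (c * a) (c * b).
Proof. by rewrite plane_ptE scalerDr !scalerA -plane_ptE. Qed.

Definition plane u v q : {vspace 'cV[R]_3 * quat R} :=
  <<[:: plane_pt u v q 1 0; plane_pt u v q 0 1]>>%VS.

Lemma planeP u v q x :
  reflect (exists a b, x = plane_pt u v q a b) (x \in plane u v q).
Proof.
rewrite /plane span_cons span_seq1.
apply: (iffP memv_addP) => [[y /vlineP[a ->] [z /vlineP[b ->] ->]]|[a [b ->]]].
  by exists a, b; exact/esym/plane_ptE.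
exists (a *: plane_pt u v q 1 0); first by apply/vlineP; exists a.
by exists (b *: plane_pt u v q 0 1); [by apply/vlineP; exists b|exact: plane_ptE].
Qed.

Lemma dot_lin u v a b : orthonormal u v ->
  dot (a *: u + b *: v) (a *: u + b *: v) = a ^+ 2 + b ^+ 2.
Proof.
case=> u1 v1 uv; transitivity
  (a ^+ 2 * dot u u + b ^+ 2 * dot v v + a * b *+ 2 * dot u v).
  by coords; ring.
by rewrite u1 v1 uv; ring.
Qed.

Lemma qnorm2_imq w : qnorm2 (imq w) = dot w w.
Proof. by rewrite qnorm2E /= expr0n add0r. Qed.

Lemma plane_pt_eq0 u v q a b : orthonormal u v ->
  plane_pt u v q a b = 0 -> a ^+ 2 + b ^+ 2 = 0.
Proof.
move=> uv [/(congr1 (fun x => dot x x)) + _]; rewrite dot_lin// => ->.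
by move=> _; apply/eqP; rewrite dot_eq0.
Qed.

Lemma dim_plane u v q : orthonormal u v -> \dim (plane u v q) = 2%N.
Proof.
move=> uv; apply/eqP; rewrite -[2%N]/(size [:: plane_pt u v q 1 0; plane_pt u v q 0 1]).
rewrite -/(free _) free_cons span_seq1 seq1_free.
apply/andP; split.
  apply/vlineP => -[c /eqP]; rewrite -subr_eq0 -scaleNr -[plane_pt _ _ _ 1 _]scale1r.
  rewrite -plane_ptE => /eqP/plane_pt_eq0 => /(_ uv) h.
  by nra.
by apply/eqP => /plane_pt_eq0 => /(_ uv); nra.
Qed.

(** The reflection b |-> - b and right multiplication by a unit quaternion are both
isometries, so the two components have the same norm. *)
Lemma null_plane u v q : orthonormal u v -> SU2 q -> null_subspace (plane u v q).
Proof.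
move=> uv q1 _ /planeP[a [b ->]]; rewrite /Ccone /Qform /=.
rewrite qnorm2M (q1 : qnorm2 q = 1) mulr1 !qnorm2_imq -scaleNr !dot_lin//.
by rewrite sqrrN subrr.
Qed.

Lemma pclassZ c (x : 'cV[R]_3 * quat R) : c != 0 -> pclass (c *: x) = pclass x.
Proof.
move=> c0; apply/seteqP; split=> _ [t /= t0 <-].
  by exists (t * c); rewrite /= ?mulf_neq0// scalerA.
by exists (t / c); rewrite /= ?mulf_neq0 ?invr_eq0// scalerA divfK.
Qed.

(** Scaling does not change a class, and a normalized vector has coordinates
(cos t, sin t). *)
Lemma proj_plane u v q : orthonormal u v -> projectivization (plane u v q) =
  [set pclass (plane_pt u v q (cos t) (sin t)) | t in [set: R]].
Proof.
move=> uv; apply/seteqP; split=> [_ [x [/planeP[a [b ->]] x0] <-]|_ [t _ <-]].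
  have n0 : 0 < a ^+ 2 + b ^+ 2.
    rewrite lt0r addr_ge0 ?sqr_ge0// andbT; apply: contra_neq x0 => /eqP.
    rewrite paddr_eq0 ?sqr_ge0// !sqrf_eq0 => /andP[/eqP -> /eqP ->].
    by rewrite plane_ptE !scale0r addr0.
  pose n := Num.sqrt (a ^+ 2 + b ^+ 2).
  have nn : n != 0 by rewrite gt_eqF// sqrtr_gt0.
  have [|t [ct st]] := @polar R (a / n) (b / n).
    by rewrite !expr_div_n -mulrDl sqr_sqrtr ?ltW// divff ?gt_eqF.
  exists t => //; rewrite ct st -(pclassZ _ nn) plane_ptZ.
  by rewrite ![n * _]mulrC !divfK.
exists (plane_pt u v q (cos t) (sin t)) => //; split.
  by apply/planeP; exists (cos t), (sin t).
apply/eqP => /plane_pt_eq0 => /(_ uv) /eqP.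
by rewrite cos2Dsin2 oner_eq0.
Qed.

Lemma line_is_plane (K : set (set ('cV[R]_3 * quat R))) : line_PC 3%:R K ->
  exists X : {vspace 'cV[R]_3 * quat R},
    [/\ \dim X = 2%N, null_subspace X & K = projectivization X].
Proof.
move=> [_ [_ /line_SU2P[u [v [q [uv q1 ->]]]] ->] ->].
have -> : (1 + 3%:R) / 2%:R = 2%:R :> R by field.
rewrite component_two_rolls//; exists (plane u v q); split.
- exact: dim_plane.
- exact: null_plane.
have pE t : tau (pm (roll 2%:R u v q t).1, (roll 2%:R u v q t).2) =
    pclass (plane_pt u v q (cos t) (sin t)).
  rewrite tau_roll//; congr (pclass (_, imq _ * _)).
  by rewrite (_ : _ * t = - t) ?/circ ?cosN ?sinN ?scaleNr//; ring.
rewrite proj_plane//; apply/seteqP; split.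
  by move=> _ [_ [_ [t _ <-] <-] <-]; exists t.
move=> _ [t _ <-]; rewrite -pE; eexists; last by [].
by exists (roll 2%:R u v q t) => //; exists t.
Qed.

(** The other lift may or may not belong to this line; for the converse it is
enough that the line contains the whole curve. *)
Lemma roll_line rho u v : orthonormal u v -> exists2 K, line_PC rho K &
  forall t, K (pclass (circ u v t, imq (circ u v ((1 - rho) / 2%:R * t)))).
Proof.
move=> uv; have [u1 v1 uv0] := uv; set k := (1 + rho) / 2%:R.
pose M := @path_component R _ (two_rolls k u v 1) (u, 1).
exists (tau @` [set (pm p.1, p.2) | p in M]) => [|t].
  exists [set (pm p.1, p.2) | p in M] => //; exists M => //.
  rewrite /M /k -preimage_roll//; last exact: SU2_1.
  eexists; last first.
    exists (u, 1) => //; rewrite preimage_roll//; last exact: SU2_1.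
    by exists 0; left; rewrite roll0.
  exists u, v, (spin_cover 1); split=> //; rewrite spin_cover1 /SO3 /=.
  by rewrite trmx1 mul1mx det1.
have -> : (1 - rho) / 2%:R = 1 - k by rewrite /k; field.
rewrite -[imq _]mulr1 -tau_roll//; eexists; last by [].
by exists (roll k u v 1 t) => //; apply: roll_component; exists t.
Qed.

(** A null subspace contains the difference of the vectors at parameters t and 0.
Its components are chords of the unit circle, and equal chords subtend angles with
the same cosine. *)
Lemma null_lines_slope rho : (forall K : set (set ('cV[R]_3 * quat R)),
    line_PC rho K -> exists X : {vspace 'cV[R]_3 * quat R},
      [/\ \dim X = 2%N, null_subspace X & K = projectivization X]) ->
  `|(1 - rho) / 2%:R| = 1.
Proof.
move=> lineX; apply: cos_scale_norm; set k := _ / _ => t.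
pose u : 'cV[R]_3 := delta_mx 0 0; pose v : 'cV[R]_3 := delta_mx 1 0.
have uv : orthonormal u v by split; rewrite /S2 /u /v /= dotE !mxE /=; ring.
have [K /lineX[X [_ nullX ->]] KP] := roll_line rho uv.
have XP s : (circ u v s, imq (circ u v (k * s))) \in X.
  have [x [xX _] xE] := KP s.
  have [c _ <-] : pclass x (circ u v s, imq (circ u v (k * s))).
    by rewrite xE; exists 1; rewrite /= ?oner_neq0// scale1r.
  by rewrite memvZ.
have := nullX _ (memvB (XP t) (XP 0)).
rewrite /Ccone /Qform /= mulr0.
rewrite (_ : imq (circ u v (k * t)) - _ = imq (circ u v (k * t) - circ u v 0)); last first.
  by qcoords; ring.
have normB s : qnorm2 (imq (circ u v s - circ u v 0)) = 2%:R - cos s *+ 2.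
  rewrite qnorm2_imq.
  transitivity (dot (circ u v s) (circ u v s) + dot (circ u v 0) (circ u v 0)
    - dot (circ u v s) (circ u v 0) *+ 2); first by coords; ring.
  by rewrite !dot_circ// !subrr subr0 cos0; ring.
by rewrite !normB; lra.
Qed.

End Planes.

Theorem theorem4 (R : realType) (rho : R) (hrho : 0 < rho) :
  rho = 3%:R <->
  (forall K : set (set ('cV[R]_3 * quat R)), line_PC rho K ->
    exists X : {vspace 'cV[R]_3 * quat R},
      [/\ \dim X = 2%N, null_subspace X & K = projectivization X]).
Proof.
split=> [->|/null_lines_slope]; first exact: line_is_plane.
by case: ger0P; lra.
Qed.
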